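(* There is a universal constant $c$ such that for all integers $n\ge 1$ and $1\le k\le n$ and every one-round $\mathsf{BCAST}(1)$ protocol $\Pi$ with $n$ processors, $$\left\|\mathcal{P}(\Pi,\mathcal{A}^n_{\mathsf{rand}})-\mathcal{P}(\Pi,\mathcal{A}^n_k)\right\|\le c\cdot\frac{k^2}{\sqrt n}.$$
   Context: **Model.** In the $\mathsf{BCAST}(1)$ (Broadcast Congested Clique) model there are $n$ processors numbered $1,\dots,n$, each holding a private input string and having unlimited computational power. Computation proceeds in synchronous rounds; in each round every processor broadcasts a single bit (the same bit to all processors), which may depend on its index, its input, its random bits (independent of the inputs) and all bits broadcast in previous rounds. The transcript is the list of all broadcast bits, together with sender and round. When the input is a matrix $A\in\{0,1\}^{n\times n}$, processor $i$ receives the $i$-th row of $A$. For a distribution $\mathcal{D}$ on $\{0,1\}^{n\times n}$, $\mathcal{P}(\Pi,\mathcal{D})$ denotes the distribution of the transcript of $\Pi$ on an input drawn from $\mathcal{D}$. **Distributions.** $\mathcal{A}^n_{\mathsf{rand}}$ is the distribution of $A\in\{0,1\}^{n\times n}$ with $A_{i,i}=0$ for all $i$ and with $A_{i,j}$ ($i\neq j$) independent uniform bits. For $C\subseteq[n]$, $\mathcal{A}^n_C$ is $\mathcal{A}^n_{\mathsf{rand}}$ conditioned on $A_{i,j}=1$ for all $i,j\in C$, $i\ne j$. $\mathcal{A}^n_k$ is the mixture of the $\mathcal{A}^n_C$ over a uniformly random $C\subseteq[n]$ with $|C|=k$. **Statistical distance.** $\|\mathcal{D}_1-\mathcal{D}_2\|=\frac12\sum_x|\mathcal{D}_1(x)-\mathcal{D}_2(x)|$.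 *)

(* Defs.v *)
From HB Require Import structures.
From mathcomp Require Import all_boot all_order all_algebra.
From mathcomp Require Import all_classical all_reals all_analysis.

Set Implicit Arguments.
Unset Strict Implicit.
Unset Printing Implicit Defensive.

Import Order.TTheory GRing.Theory Num.Theory.

Local Open Scope ring_scope.

(* A BCAST(1) protocol with [T] rounds for [n] processors, processor [i]
   holding a row of [n] bits. The random bits live on a probability space
   of their own; since the transcript law below uses the product of the input
   law with [prob], they are independent of the input. No other assumption is
   made on their joint law, so private, shared and biased bits are all covered.
   The round number is the size of the history given to [bcast], whose entries
   are the vectors of bits broadcast in the previous rounds, in order. *)
Record bcast1 (R : realType) (n T : nat) := Bcast1 {
  disp : measure_display ;
  Omega : measurableType disp ;
  prob : probability Omega R ;
  rbits : 'I_n -> Omega -> nat -> bool ;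
  bcast : 'I_n -> 'rV[bool]_n -> (nat -> bool) ->
          seq {ffun 'I_n -> bool} -> bool ;
  measurable_rbits : forall i j, measurable_fun setT (fun w => rbits i w j) ;
  measurable_bcast : forall i x h,
    measurable_fun setT (fun w => bcast i x (rbits i w) h)
}.

Section Transcript.
Variables (R : realType) (n T : nat) (Pi : bcast1 R n T).

Fixpoint run (A : 'M[bool]_n) (w : Omega Pi) (t : nat) :
    seq {ffun 'I_n -> bool} :=
  if t is t'.+1 then
    let h := run A w t' in
    rcons h [ffun i => bcast Pi i (row i A) (rbits i w) h]
  else [::].

Lemma size_run A w t : size (run A w t) == t.
Proof. by elim: t => //= t /eqP IH; rewrite size_rcons IH. Qed.

Definition transcript A w : T.-tuple {ffun 'I_n -> bool} :=
  Tuple (size_run A w T).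

Definition transcript_dist (D : 'M[bool]_n -> R)
    (t : T.-tuple {ffun 'I_n -> bool}) : R :=
  \sum_(A : 'M[bool]_n) D A * fine (prob Pi [set w | transcript A w = t]%classic).

End Transcript.

Section Distributions.
Variables (R : realType).

Definition stat_dist (X : finType) (D1 D2 : X -> R) : R :=
  2^-1 * \sum_(x : X) `|D1 x - D2 x|.

Definition cond_dist (X : finType) (D : X -> R) (E : pred X) (x : X) : R :=
  if E x then D x / \sum_(y | E y) D y else 0.

Variable n : nat.

Definition A_rand (A : 'M[bool]_n) : R :=
  \prod_(i < n) \prod_(j < n) (if i == j then (A i j == false)%:R else 2^-1).

Definition is_clique (C : {set 'I_n}) (A : 'M[bool]_n) : bool :=
  [forall i in C, forall j in C, (i != j) ==> A i j].

Definition A_clique (C : {set 'I_n}) : 'M[bool]_n -> R :=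
  cond_dist A_rand (is_clique C).

Definition A_planted (k : nat) (A : 'M[bool]_n) : R :=
  (#|[pred C : {set 'I_n} | #|C| == k]|%:R)^-1 *
  \sum_(C : {set 'I_n} | #|C| == k) A_clique C A.

End Distributions.

(* Main.v *)
(* For fixed random bits a one-round transcript is a vector of bits, the [i]-th being a
   function of row [i] alone, so under [A_rand] and under each [A_clique C] it has a product
   law. Hence its statistical distance for a fixed [C] is at most the sum over [i] in [C] of
   the change in the law of one bit [f] caused by forcing the coordinates [C :\ i] to 1.
   Averaged over [C], the coordinates are forced one after the other, each uniform among
   the remaining [N] ones; such a step costs on average at most [1 / sqrt N], by
   orthonormality of the degree-one characters. Summing [k - 1] steps over [k] rows gives
   [O(k ^ 2 / sqrt n)]. *)
Require Import Defs.
From HB Require Import structures.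
From mathcomp Require Import all_boot all_order all_algebra.
From mathcomp Require Import all_classical all_reals all_analysis.
From mathcomp Require Import ring lra zify.

Set Implicit Arguments.
Unset Strict Implicit.
Unset Printing Implicit Defensive.

Import Order.TTheory GRing.Theory Num.Theory.

Local Open Scope ring_scope.

(** * Double counting, product laws and distributivity over finite sums *)

(** For fixed [j], deleting [j] is a bijection from the sets containing [j] to those avoiding it.
    This serves both to force coordinates one at a time and to draw a row of the clique before the
    rest of the clique. *)
Lemma sum_draws_succ (V : nmodType) (T : finType) (B : {set T}) (m : nat)
    (H : T -> {set T} -> V) :
  \sum_(C : {set T} | (C \subset B) && (#|C| == m.+1)) \sum_(j in C) H j (C :\ j)
  = \sum_(S : {set T} | (S \subset B) && (#|S| == m)) \sum_(j in B :\: S) H j S.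
Proof.
rewrite (exchange_big_dep xpredT) //= [RHS](exchange_big_dep xpredT) //=.
apply: eq_bigr => j _.
rewrite (reindex_onto (fun S => j |: S) (fun S => S :\ j)); last first.
  by move=> C /andP[_ jC]; rewrite finset.setD1K.
apply: eq_big => [S|S].
  have [jS|jS] := boolP (j \in S).
    have -> : ((j |: S) :\ j == S) = false.
      by apply/eqP => E; move: jS; rewrite -E finset.in_setD1 eqxx.
    by rewrite finset.in_setD jS /= !andbF.
  rewrite finset.setU1K // eqxx finset.setU11 cardsU1 jS finset.in_setD jS eqSS.
  by rewrite finset.subUset finset.sub1set /= !andbT -andbA andbC.
by move=> /andP[_ /eqP ->].
Qed.

(** Hybrid argument: [H m] takes its factors from [p] below [m] and from [q] elsewhere. Consecutive
    hybrids differ in one factor, and the other factors have total mass 1. *)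
Lemma sum_prod_dist_le (R : realDomainType) (n : nat) (Y : finType)
    (p q : 'I_n -> Y -> R) :
  (forall i y, 0 <= p i y) -> (forall i y, 0 <= q i y) ->
  (forall i, \sum_y p i y = 1) -> (forall i, \sum_y q i y = 1) ->
  \sum_(t : {ffun 'I_n -> Y}) `|\prod_i p i (t i) - \prod_i q i (t i)|
  <= \sum_i \sum_y `|p i y - q i y|.
Proof.
move=> p0 q0 p1 q1.
pose H (m : nat) (t : {ffun 'I_n -> Y}) :=
  \prod_(i < n) (if (i < m)%N then p i (t i) else q i (t i)).
have step (m : 'I_n) :
    \sum_t `|H m.+1 t - H m t| = \sum_y `|p m y - q m y|.
  (* With the absolute value moved into factor [m], the difference of two hybrids is again a
     product, so its sum over [t] factorises. *)
  pose K (i : 'I_n) (y : Y) := if (i < m)%N then p i y else if i == m then `|p m y - q m y|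
                else q i y.
  transitivity (\sum_(t : {ffun 'I_n -> Y}) \prod_i K i (t i)).
    apply: eq_bigr => t _; rewrite /H.
    rewrite (bigD1 m) //= ltnSn [X in _ - X](bigD1 m) //= ltnn.
    rewrite [RHS](bigD1 m) //= /K ltnn eqxx.
    have E1 : \prod_(i < n | i != m) (if (i < m.+1)%N then p i (t i) else q i (t i))
       = \prod_(i < n | i != m) K i (t i).
      apply: eq_bigr => i im; rewrite /K (negbTE im) ltnS leq_eqVlt.
      by rewrite (inj_eq val_inj) (negbTE im).
    have E2 : \prod_(i < n | i != m) (if (i < m)%N then p i (t i) else q i (t i))
       = \prod_(i < n | i != m) K i (t i).
      by apply: eq_bigr => i im; rewrite /K (negbTE im).
    rewrite E1 E2 -mulrBl normrM [X in _ * X]ger0_norm //.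
    by apply: prodr_ge0 => i im; rewrite /K (negbTE im); case: ifP.
  rewrite -bigA_distr_bigA (bigD1 m) //= [X in _ * X]big1 ?mulr1.
    by apply: eq_bigr => y _; rewrite /K ltnn eqxx.
  move=> i im; rewrite /K (negbTE im); case: (i < m)%N; [exact: p1|exact: q1].
rewrite -(eq_bigr _ (fun m _ => step m)) exchange_big /=.
apply: ler_sum => t _.
have -> : \prod_i p i (t i) = H n t by apply: eq_bigr => i _; rewrite ltn_ord.
have -> : \prod_i q i (t i) = H 0%N t by [].
rewrite -(telescope_sumr (fun m => H m t) (leq0n n)) big_mkord.
exact: ler_norm_sum.
Qed.

Lemma sum_mx_prod (R : comNzRingType) (m n : nat) (G : 'I_m -> 'rV[bool]_n -> R) :
  \sum_(A : 'M[bool]_(m, n)) \prod_i G i (row i A) = \prod_i \sum_x G i x.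
Proof.
rewrite bigA_distr_bigA.
rewrite (reindex_onto (fun t : {ffun 'I_m -> 'rV[bool]_n} => \matrix_(i, j) t i 0 j)
                      (fun A => [ffun i => row i A])) /=.
  apply: eq_big => [t|t _].
    rewrite (_ : [ffun i => _] = t) ?eqxx //; apply/ffunP => i.
    by rewrite ffunE; apply/rowP => j; rewrite !mxE.
  by apply: eq_bigr => i _; congr G; apply/rowP => j; rewrite !mxE.
by move=> A _; apply/matrixP => i j; rewrite !mxE ffunE mxE.
Qed.

Lemma sum_rV_prod (R : comNzRingType) (n : nat) (u : 'I_n -> bool -> R) :
  \sum_(x : 'rV[bool]_n) \prod_j u j (x 0 j) = \prod_j \sum_b u j b.
Proof.
rewrite bigA_distr_bigA.
rewrite (reindex_onto (fun t : {ffun 'I_n -> bool} => \row_j t j)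
                      (fun x : 'rV_n => [ffun j => x 0 j])) /=.
  apply: eq_big => [t|t _].
    rewrite (_ : [ffun j => _] = t) ?eqxx //.
    by apply/ffunP => i; rewrite ffunE mxE.
  by apply: eq_bigr => i _; rewrite mxE.
by move=> x _; apply/rowP => j; rewrite mxE ffunE.
Qed.

(** * The law of one row with some coordinates forced to 1 *)

Section RowLaw.
Variables (R : realType) (n : nat) (i : 'I_n).
Implicit Types (S : {set 'I_n}) (x : 'rV[bool]_n) (f : 'rV[bool]_n -> bool).

Definition bit_law S (j : 'I_n) (b : bool) : R :=
  if j == i then (b == false)%:R else if j \in S then b%:R else 2^-1.

Definition row_law S x : R := \prod_j bit_law S j (x 0 j).

Definition row_prob S f : R := \sum_x row_law S x * (f x)%:R.

(** The character of one bit, signed so that [1 + sign_bit b] is the density of the constant bit 1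
    with respect to a uniform bit. *)
Definition sign_bit (b : bool) : R := if b then 1 else -1.

Lemma sum_bit_law S j : \sum_b bit_law S j b = 1.
Proof.
rewrite big_bool /bit_law; case: ifP => _; first by rewrite /= add0r.
by case: ifP => _ /=; lra.
Qed.

Lemma row_law_ge0 S x : 0 <= row_law S x.
Proof.
apply: prodr_ge0 => j _; rewrite /bit_law; case: ifP => _ //.
by case: ifP => _ //; rewrite invr_ge0.
Qed.

Lemma sum_row_law S : \sum_x row_law S x = 1.
Proof. by rewrite sum_rV_prod big1 // => j _; exact: sum_bit_law. Qed.

Lemma row_prob_ge0 S f : 0 <= row_prob S f.
Proof. by apply: sumr_ge0 => x _; rewrite mulr_ge0 // row_law_ge0. Qed.

Lemma row_prob_le1 S f : row_prob S f <= 1.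
Proof.
rewrite -(sum_row_law S); apply: ler_sum => x _.
by case: (f x); rewrite ?mulr1 ?mulr0 ?row_law_ge0.
Qed.

Lemma row_law_setU1 S j x : j != i -> j \notin S ->
  row_law (j |: S) x = row_law S x * (1 + sign_bit (x 0 j)).
Proof.
move=> ji jS; rewrite /row_law (bigD1 j) //= [in RHS](bigD1 j) //=.
have -> : bit_law (j |: S) j (x 0 j) = bit_law S j (x 0 j) * (1 + sign_bit (x 0 j)).
  rewrite /bit_law (negbTE ji) finset.setU11 (negbTE jS) /sign_bit.
  by case: (x 0 j) => /=; lra.
rewrite mulrAC; congr (_ * _ * _); apply: eq_bigr => l lj.
by rewrite /bit_law finset.in_setU1 (negbTE lj).
Qed.

(** Orthonormality of characters: for [l] distinct from [j], the free bit [j] is uniform and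
    independent of bit [l], so its sign averages to 0. *)
Lemma row_law_sign2 S j l : j != i -> j \notin S ->
  \sum_x row_law S x * (sign_bit (x 0 j) * sign_bit (x 0 l)) = (j == l)%:R.
Proof.
move=> ji jS; have [<-|jl] := eqVneq j l.
  rewrite -(sum_row_law S); apply: eq_bigr => x _.
  by rewrite /sign_bit; case: (x 0 j); rewrite ?mulrNN !mulr1.
pose u m b := bit_law S m b *
  ((if m == j then sign_bit b else 1) * (if m == l then sign_bit b else 1)).
transitivity (\sum_(x : 'rV[bool]_n) \prod_m u m (x 0 m)).
  apply: eq_bigr => x _; rewrite /u !big_split /=; congr (_ * (_ * _)).
    by rewrite -big_mkcond big_pred1_eq.
  by rewrite -big_mkcond big_pred1_eq.
rewrite sum_rV_prod (bigD1 j) //= big_bool /u eqxx (negbTE jl).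
rewrite /bit_law (negbTE ji) (negbTE jS) /sign_bit /= !mulr1 mulrN1 subrr.
by rewrite mul0r.
Qed.

(* Forcing bit [j] changes [E[f]] by [E[f chi_j]], where the characters [chi_j] of
   the free coordinates are orthonormal; with [g] their sum with suitable signs, the
   left-hand side is [E[f g]], at most [sqrt (E[g ^+ 2])]. *)
Lemma sum_influence_le S f :
  \sum_(j in [set~ i] :\: S) `|row_prob (j |: S) f - row_prob S f|
  <= Num.sqrt (#|[set~ i] :\: S|%:R).
Proof.
set J := _ :\: S; set s := Num.sqrt _.
have JP j : j \in J -> (j != i) /\ (j \notin S).
  by rewrite !inE => /andP[-> ->].
have [J0|J0] := posnP #|J|.
  by rewrite (cards0_eq J0) big_set0 sqrtr_ge0.
have s0 : 0 < s by rewrite sqrtr_gt0 ltr0n.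
have s2 : s ^+ 2 = #|J|%:R by rewrite sqr_sqrtr.
pose a j := row_prob (j |: S) f - row_prob S f.
pose g x : R := \sum_(j in J) Num.sg (a j) * sign_bit (x 0 j).
have aE j : j \in J -> a j = \sum_x row_law S x * (sign_bit (x 0 j) * (f x)%:R).
  move=> /JP[ji jS]; rewrite /a /row_prob -sumrB; apply: eq_bigr => x _.
  by rewrite row_law_setU1 //; ring.
have Eg : \sum_(j in J) `|a j| = \sum_x row_law S x * ((f x)%:R * g x).
  transitivity (\sum_(j in J) \sum_x
      row_law S x * ((f x)%:R * (Num.sg (a j) * sign_bit (x 0 j)))).
    apply: eq_bigr => j jJ; rewrite normrEsg {2}aE // mulr_sumr.
    by apply: eq_bigr => x _; ring.
  rewrite exchange_big /=; apply: eq_bigr => x _.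
  by rewrite /g !mulr_sumr.
have Eg2 : \sum_x row_law S x * g x ^+ 2 <= #|J|%:R.
  have -> : \sum_x row_law S x * g x ^+ 2 = \sum_(j in J) Num.sg (a j) ^+ 2.
    transitivity (\sum_(j in J) \sum_(l in J) Num.sg (a j) * Num.sg (a l) *
        \sum_x row_law S x * (sign_bit (x 0 j) * sign_bit (x 0 l))).
      under [RHS]eq_bigr => j _ do
        (under eq_bigr => l _ do rewrite mulr_sumr; rewrite exchange_big /=).
      rewrite [RHS]exchange_big /=; apply: eq_bigr => x _.
      rewrite expr2 /g mulr_suml mulr_sumr; apply: eq_bigr => j _.
      by rewrite !mulr_sumr; apply: eq_bigr => l _; ring.
    apply: eq_bigr => j jJ; have [ji jS] := JP _ jJ.
    rewrite (bigD1 j) //= [X in _ + X]big1 => [|l /andP[_ lj]].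
      by rewrite row_law_sign2 // eqxx mulr1 addr0 expr2.
    by rewrite row_law_sign2 // eq_sym (negbTE lj) mulr0.
  rewrite -sum1_card natr_sum; apply: ler_sum => j _.
  by rewrite sqr_sg; case: (_ != _).
(* Cauchy-Schwarz through the pointwise bound [2 * s * f * g <= s ^+ 2 + g ^+ 2], where [f] is 0 or
   1; both terms on the right have mean at most [s ^+ 2]. *)
have H : s * (2 * \sum_(j in J) `|a j|) <= s * (2 * s).
  have -> : s * (2 * s) = s ^+ 2 * \sum_x row_law S x + #|J|%:R.
    by rewrite sum_row_law -s2; ring.
  rewrite Eg; apply: le_trans (lerD (lexx _) Eg2).
  rewrite !mulr_sumr -big_split /=; apply: ler_sum => x _.
  have -> : s * (2 * (row_law S x * ((f x)%:R * g x))) =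
    row_law S x * (2 * s * (f x)%:R * g x) by ring.
  have -> : s ^+ 2 * row_law S x + row_law S x * g x ^+ 2 =
    row_law S x * (s ^+ 2 + g x ^+ 2) by ring.
  rewrite ler_wpM2l ?row_law_ge0 //.
  have := sqr_ge0 (s - g x); have := sqr_ge0 s; have := sqr_ge0 (g x).
  by case: (f x) => /=; lra.
by move: H; rewrite ler_pM2l // ler_pM2l.
Qed.

(** Each set of size [m.+1] arises in [m.+1] ways as [j |: S]. The triangle inequality through [S]
    leaves the shift of [S], once per free [j], plus the total influence bounded by
    [sum_influence_le]. *)
Lemma sum_row_prob_shift_rec m f :
  m.+1%:R * (\sum_(S : {set 'I_n} | (S \subset [set~ i]) && (#|S| == m.+1))
               `|row_prob S f - row_prob finset.set0 f|)
  <= (n.-1 - m)%:R * (\sum_(S : {set 'I_n} | (S \subset [set~ i]) && (#|S| == m))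
               `|row_prob S f - row_prob finset.set0 f|)
     + Num.sqrt (n.-1 - m)%:R * 'C(n.-1, m)%:R.
Proof.
set P := fun m (S : {set 'I_n}) => (S \subset [set~ i]) && (#|S| == m).
pose D S := `|row_prob S f - row_prob finset.set0 f|.
have ci : #|[set~ i]| = n.-1 by rewrite cardsC1 card_ord.
have -> : 'C(n.-1, m)%:R = \sum_(S | P m S) 1 :> R.
  rewrite -ci -cards_draws -sum1_card natr_sum; apply: eq_bigl => S.
  by rewrite inE.
have -> : m.+1%:R * (\sum_(S | P m.+1 S) D S) =
    \sum_(S | P m S) \sum_(j in [set~ i] :\: S) D (j |: S).
  rewrite -(sum_draws_succ [set~ i] m (fun j S => D (j |: S))) mulr_sumr.
  apply: eq_bigr => S /andP[_ /eqP cS].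
  rewrite (eq_bigr (fun=> D S)) => [|j jS]; last by rewrite finset.setD1K.
  by rewrite sumr_const cS mulr_natl.
rewrite !mulr_sumr -big_split /=; apply: ler_sum => S /andP[Si /eqP cS].
have cJ : #|[set~ i] :\: S| = (n.-1 - m)%N.
  by rewrite finset.cardsD (finset.setIidPr Si) ci cS.
have := sum_influence_le S f; rewrite cJ mulr1.
move/(lerD (lexx ((n.-1 - m)%:R * D S))); apply: le_trans.
rewrite mulr_natl -cJ -sumr_const -big_split /=; apply: ler_sum => j _.
rewrite /D addrC; apply: le_trans (ler_normD _ _).
by rewrite addrA subrK.
Qed.

(** After division by the binomial, the recursion says that the mean shift grows by at most the
    inverse square root of the number of free coordinates. That number stays at least [n / 4] unless
    the bound is trivial. *)
Lemma sum_row_prob_shift_le m f :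
  \sum_(S : {set 'I_n} | (S \subset [set~ i]) && (#|S| == m))
     `|row_prob S f - row_prob finset.set0 f|
  <= 2 * m.+1%:R / Num.sqrt n%:R * 'C(n.-1, m)%:R.
Proof.
have n0 : (0 < n)%N by apply: leq_ltn_trans (ltn_ord i).
set s := Num.sqrt n%:R.
have s0 : 0 < s by rewrite sqrtr_gt0 ltr0n.
have s2 : s ^+ 2 = n%:R by rewrite sqr_sqrtr.
have s1 : 1 <= s by rewrite -sqrtr1 ler_wsqrtr // ler1n.
(* In the first case the factor [2 * m.+1 / s] is at least 1. *)
have [big|small] := leP s (2 * m.+1%:R).
  have -> : 'C(n.-1, m) = #|[set S : {set 'I_n} | (S \subset [set~ i]) && (#|S| == m)]|.
    by rewrite cards_draws cardsC1 card_ord.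
  rewrite -sum1_card natr_sum mulr_sumr big_set; apply: ler_sum => S _.
  rewrite mulr1; apply: (@le_trans _ _ 1); last by rewrite ler_pdivlMr // mul1r.
  rewrite ler_norml; have := row_prob_ge0 S f; have := row_prob_le1 S f.
  by have := row_prob_ge0 finset.set0 f; have := row_prob_le1 finset.set0 f; lra.
(* In the second case [2 * m.+1 < s <= s ^+ 2 = n]. *)
have sn : 2 * m.+1%:R < n%:R :> R by rewrite -s2; nra.
have {}sn : (2 * m.+1 < n)%N by move: sn; rewrite -natrM ltr_nat.
(* The induction carries [l] instead of [l.+1], as the shift is 0 for the empty set. *)
suff H l : (l <= m)%N ->
  \sum_(S : {set 'I_n} | (S \subset [set~ i]) && (#|S| == l))
     `|row_prob S f - row_prob finset.set0 f| <= 2 * l%:R / s * 'C(n.-1, l)%:R.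
  apply: le_trans (H m (leqnn m)) _; apply: ler_wpM2r => //.
  by apply: ler_wpM2r; [rewrite invr_ge0 ltW|rewrite ler_wpM2l // ler_nat].
elim: l => [_|l IH lm].
  rewrite mulr0 !mul0r big1 // => S /andP[_ /eqP/cards0_eq ->].
  by rewrite subrr normr0.
have {IH} := IH (ltnW lm); set Tl := \sum_(S | _) _ => IH.
have l0 : 0 < l.+1%:R :> R by rewrite ltr0n.
rewrite -(ler_pM2l l0); apply: le_trans (sum_row_prob_shift_rec l f) _.
set N := (n.-1 - l)%N; rewrite -/Tl.
have binE : l.+1%:R * 'C(n.-1, l.+1)%:R = N%:R * 'C(n.-1, l)%:R :> R.
  by rewrite -!natrM mul_bin_left.
have -> : l.+1%:R * (2 * l.+1%:R / s * 'C(n.-1, l.+1)%:R) =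
   N%:R * (2 * l%:R / s * 'C(n.-1, l)%:R) + (2 * N%:R / s) * 'C(n.-1, l)%:R.
  transitivity (2 * l.+1%:R / s * (l.+1%:R * 'C(n.-1, l.+1)%:R)); first by ring.
  rewrite binE -[l.+1%:R]natr1; ring.
apply: lerD; first by rewrite ler_wpM2l.
rewrite ler_wpM2r //.
set r := Num.sqrt N%:R.
have r2 : r ^+ 2 = N%:R by rewrite sqr_sqrtr.
have r0 : 0 <= r by rewrite sqrtr_ge0.
(* Fewer than half of the coordinates are forced, so [n <= 4 * N]. *)
have sr : s <= 2 * r.
  have -> : 2 * r = Num.sqrt (4 * N%:R).
    by rewrite sqrtrM // (_ : 4 = 2 ^+ 2 :> R) ?sqrtr_sqr ?ger0_norm //; ring.
  rewrite ler_wsqrtr // -natrM ler_nat /N; move: lm sn n0; clear; lia.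
by rewrite ler_pdivlMr // -r2; nra.
Qed.

End RowLaw.

(** * Finite-valued random variables and tuples of length one *)

Lemma fine_prob_finType (R : realType) (d : measure_display)
    (Om : measurableType d) (P : probability Om R) (Y : finType) (X : Om -> Y)
    (Q : pred Y) :
  (forall y, measurable [set w | X w = y]%classic) ->
  fine (P [set w | Q (X w)]%classic) =
  \sum_(y | Q y) fine (P [set w | X w = y]%classic).
Proof.
move=> mX; rewrite sum_fine => [|y _]; last exact: fin_num_measure.
rewrite -big_enum /= (fsbig_seq _ _ (enum_uniq Q)) -measure_fin_bigcup //.
- congr (fine (P _)); apply/seteqP; split => w /=.
    by move=> Qw; exists (X w) => //=; rewrite mem_enum.
  by move=> [y /=]; rewrite mem_enum => Qy ->.
- by move=> y z _ _ [w [/= <- <-]].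
Qed.

Lemma sum_tuple1 (V : nmodType) (Y : finType) (G : 1.-tuple Y -> V) :
  \sum_t G t = \sum_y G [tuple y].
Proof.
rewrite (reindex (fun y : Y => [tuple y])) //=.
exists (fun t : 1.-tuple Y => thead t) => // t _.
by case/tupleP: t => y t; rewrite [t]tuple0; apply/val_inj.
Qed.

(** * One-round protocols as mixtures of deterministic ones, and the average over cliques *)

Section OneRound.
Variables (R : realType) (n : nat).
Implicit Types (F : {ffun 'I_n * 'rV[bool]_n -> bool}) (A : 'M[bool]_n).
Implicit Types (C : {set 'I_n}) (s : {ffun 'I_n -> bool}).

Definition broadcast F A : {ffun 'I_n -> bool} := [ffun i => F (i, row i A)].

(** In the only round the history is empty, so [w] matters only through this map from indices and
    rows to bits. It ranges over a finite type, which turns the average over [Omega] into a finite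
    sum. *)
Definition strategy (Pi : bcast1 R n 1) (w : Omega Pi) :
    {ffun 'I_n * 'rV[bool]_n -> bool} :=
  [ffun u => bcast Pi u.1 u.2 (rbits u.1 w) [::]].

Lemma measurable_strategy (Pi : bcast1 R n 1) F :
  measurable [set w | strategy (Pi := Pi) w = F]%classic.
Proof.
have -> : [set w | strategy (Pi := Pi) w = F]%classic =
  (\bigcap_(u in [set: 'I_n * 'rV[bool]_n])
    ((fun w => bcast Pi u.1 u.2 (rbits u.1 w) [::]) @^-1` [set F u]))%classic.
  apply/seteqP; split => w /=.
    by move=> <- u _ /=; rewrite ffunE.
  by move=> H; apply/ffunP => u; rewrite ffunE; exact: (H u I).
apply: fin_bigcap_measurable => // u _.
rewrite -[X in measurable X]setTI.
by apply: measurable_bcast.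
Qed.

(** The transcript is determined by the input and the strategy, so each transcript event splits into
    the events fixing the strategy. *)
Lemma transcript_dist_mixture (Pi : bcast1 R n 1) (D : 'M[bool]_n -> R) s :
  transcript_dist Pi D [tuple s] =
  \sum_F fine (prob Pi [set w | strategy w = F]%classic) *
         \sum_(A | broadcast F A == s) D A.
Proof.
rewrite /transcript_dist.
under [RHS]eq_bigr => F _ do rewrite mulr_sumr.
rewrite [RHS](exchange_big_dep xpredT) //=; apply: eq_bigr => A _.
have -> : [set w | transcript A w = [tuple s]]%classic =
  [set w | broadcast (strategy (Pi := Pi) w) A == s]%classic.
  have bE (w : Omega Pi) : [ffun i => bcast Pi i (row i A) (rbits i w) [::]] =
      broadcast (strategy w) A by apply/ffunP => i; rewrite !ffunE.
  apply/seteqP; split => w /=.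
    by move=> /(congr1 val) /= [<-]; rewrite bE.
  by move=> /eqP <-; apply/val_inj; rewrite /= bE.
rewrite (fine_prob_finType _ (fun F => broadcast F A == s)); last first.
  exact: measurable_strategy.
by rewrite mulr_sumr; apply: eq_bigr => F _; rewrite mulrC.
Qed.

Lemma sum_strategy (Pi : bcast1 R n 1) :
  \sum_F fine (prob Pi [set w | strategy w = F]%classic) = 1.
Proof.
rewrite -(fine_prob_finType (X := strategy (Pi := Pi)) _ xpredT); last first.
  exact: measurable_strategy.
by rewrite (_ : [set w | _]%classic = setT) ?probability_setT //; apply/seteqP.
Qed.

(* The off-diagonal bits of row [i] that are set to 1 by planting a clique on [C]. *)
Definition forced C (i : 'I_n) : {set 'I_n} := if i \in C then C :\ i else finset.set0.

Definition mx_law C A : R := \prod_i row_law R i (forced C i) (row i A).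

Lemma sum_mx_law C : \sum_A mx_law C A = 1.
Proof. rewrite /mx_law (sum_mx_prod (fun i => row_law R i (forced C i))).
by rewrite big1 // => i _; exact: sum_row_law. Qed.

Lemma A_randE A : A_rand R A = \prod_i row_law R i finset.set0 (row i A).
Proof.
apply: eq_bigr => i _; apply: eq_bigr => j _.
by rewrite /bit_law !mxE finset.in_set0 eq_sym; case: eqP => // ->.
Qed.

(** The clique event is a product of entrywise conditions, so restricting [A_rand] to it gives a
    multiple of [mx_law C]. Since [mx_law C] has mass 1, the multiple is the probability of the
    event. *)
Lemma A_cliqueE C A : A_clique R C A = mx_law C A.
Proof.
pose on i j := [&& i \in C, j \in C & i != j].
(* One factor 1/2 for each off-diagonal entry inside [C]. *)
pose c : R := \prod_i \prod_j (if on i j then 2^-1 else 1).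
have c0 : c != 0.
  by apply/prodf_neq0 => i _; apply/prodf_neq0 => j _; case: ifP; rewrite ?invr_eq0.
have key B : (if is_clique C B then A_rand R B else 0) = c * mx_law C B.
  have -> : (if is_clique C B then A_rand R B else 0) =
     A_rand R B * \prod_i \prod_j (if on i j then (B i j)%:R else 1).
    have [/forall_inP cl|ncl] := boolP (is_clique C B).
      rewrite big1 ?mulr1 // => i _; rewrite big1 // => j _.
      rewrite /on; case: ifP => // /and3P[iC jC ij].
      by have /forall_inP/(_ j jC)/implyP/(_ ij) -> := cl i iC.
    move: ncl; rewrite /is_clique negb_forall_in => /exists_inP[i iC].
    rewrite negb_forall_in => /exists_inP[j jC].
    rewrite negb_imply => /andP[ij /negbTE Bij].
    rewrite (bigD1 i) //= (bigD1 j) //= /on iC jC ij Bij.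
    by rewrite !mul0r mulr0.
  rewrite A_randE /mx_law /c -!big_split; apply: eq_bigr => i _ /=.
  rewrite -!big_split; apply: eq_bigr => j _ /=.
  rewrite /bit_law /forced /on !mxE finset.in_set0 eq_sym.
  have [ij|ij] := eqVneq i j; first by rewrite !andbF !mulr1 mul1r.
  rewrite andbT; have [iC|iC] := boolP (i \in C); last first.
    by rewrite /= finset.in_set0 mulr1 mul1r.
  rewrite finset.in_setD1 eq_sym ij /=.
  by case: ifP => _ //; rewrite mulr1 mul1r.
rewrite /A_clique /cond_dist.
have -> : \sum_(B | is_clique C B) A_rand R B = c.
  by rewrite big_mkcond /= (eq_bigr _ (fun B _ => key B)) -mulr_sumr sum_mx_law mulr1.
have := key A; case: ifP => _ E; first by rewrite E mulrC mulKf.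
(* Off the clique event, [key] reads [0 = c * mx_law C A] with [c] nonzero. *)
by apply/esym/eqP; rewrite -(mulrI_eq0 _ (mulfI c0)) -E.
Qed.

(** The rows are independent and bit [i] depends on row [i] alone, so the indicator of the output
    [s] also factors over rows. *)
Lemma sum_broadcast (S : 'I_n -> {set 'I_n}) F s :
  \sum_(A | broadcast F A == s) \prod_i row_law R i (S i) (row i A) =
  \prod_i row_prob R i (S i) (fun x => F (i, x) == s i).
Proof.
rewrite -(sum_mx_prod
  (fun i x => row_law R i (S i) x * (F (i, x) == s i)%:R)) big_mkcond.
apply: eq_bigr => A _ /=.
rewrite big_split /=; case: eqP => [<-|ne].
  by rewrite [X in _ * X]big1 ?mulr1 // => i _; rewrite ffunE eqxx.
have /existsP[i si] : [exists i, F (i, row i A) != s i].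
  apply: contra_notT ne; rewrite negb_exists => /forallP H.
  by apply/ffunP => i; rewrite ffunE; apply/eqP; have := H i; rewrite negbK.
by rewrite [X in _ * X](bigD1 i) //= (negbTE si) mul0r mulr0.
Qed.

Lemma sum_row_prob_eq S (i : 'I_n) (h : 'rV[bool]_n -> bool) :
  \sum_b row_prob R i S (fun x => h x == b) = 1.
Proof.
rewrite exchange_big /= -[RHS](sum_row_law R i S); apply: eq_bigr => x _.
by rewrite -mulr_sumr big_bool; case: (h x); rewrite /= ?addr0 ?add0r mulr1.
Qed.

(** Rows outside [C] have the same law on both sides, so they drop out of the hybrid sum. *)
Lemma dist_broadcast_clique_le F C :
  \sum_s `|\sum_(A | broadcast F A == s) (A_rand R A - A_clique R C A)|
  <= \sum_(i in C) \sum_b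
     `|row_prob R i (C :\ i) (fun x => F (i, x) == b)
       - row_prob R i finset.set0 (fun x => F (i, x) == b)|.
Proof.
pose p i b := row_prob R i finset.set0 (fun x => F (i, x) == b).
pose q i b := row_prob R i (forced C i) (fun x => F (i, x) == b).
apply: (@le_trans _ _ (\sum_i \sum_b `|p i b - q i b|)).
  have -> : \sum_s `|\sum_(A | broadcast F A == s) (A_rand R A - A_clique R C A)| =
    \sum_(s : {ffun 'I_n -> bool}) `|\prod_i p i (s i) - \prod_i q i (s i)|.
    apply: eq_bigr => s _; rewrite sumrB -!sum_broadcast.
    congr `|_ - _|; apply: eq_bigr => A _; first exact: A_randE.
    exact: A_cliqueE.
  apply: sum_prod_dist_le => i *; rewrite ?row_prob_ge0 //; exact: sum_row_prob_eq.
rewrite [X in X <= _](bigID (mem C)) /= [X in _ + X]big1 ?addr0 => [|i iC].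
  apply: ler_sum => i iC; apply: ler_sum => b _.
  by rewrite /q /forced iC distrC.
by rewrite big1 // => b _; rewrite /p /q /forced (negbTE iC) subrr normr0.
Qed.

(** Choosing [i] first, the rest of the clique is any set of [k - 1] other indices, so the one-row
    bound applies. The constant 4 is its constant 2 times the two values of [b]. *)
Lemma sum_clique_shift_le F k : (0 < k <= n)%N ->
  \sum_(C : {set 'I_n} | #|C| == k) \sum_(i in C) \sum_b
     `|row_prob R i (C :\ i) (fun x => F (i, x) == b)
       - row_prob R i finset.set0 (fun x => F (i, x) == b)|
  <= 4 * (k%:R ^+ 2 / Num.sqrt n%:R) * 'C(n, k)%:R.
Proof.
case: k => // m /andP[_ mn].
rewrite (eq_bigl (fun C : {set 'I_n} => (C \subset [set: 'I_n]) && (#|C| == m.+1)));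
  last by move=> C; rewrite finset.subsetT.
rewrite (sum_draws_succ _ _ (fun i S => \sum_b
  `|row_prob R i S (fun x => F (i, x) == b)
    - row_prob R i finset.set0 (fun x => F (i, x) == b)|)).
rewrite (exchange_big_dep xpredT) //=.
apply: (@le_trans _ _ (\sum_(i < n) \sum_(b : bool)
    2 * m.+1%:R / Num.sqrt n%:R * 'C(n.-1, m)%:R)).
  apply: ler_sum => i _; rewrite exchange_big /=; apply: ler_sum => b _.
  rewrite (eq_bigl (fun S : {set 'I_n} => (S \subset [set~ i]) && (#|S| == m))).
    exact: sum_row_prob_shift_le.
  move=> S; rewrite finset.subsetT finset.in_setD finset.in_setT andbT /= andbC.
  by rewrite finset.subsetC finset.sub1set finset.in_setC.
rewrite big_bool sumr_const card_ord -[X in X <= _]mulr_natl.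
(* Pairs of a clique and one of its rows, counted in both orders: this gives the second factor
   [k]. *)
have E : n%:R * 'C(n.-1, m)%:R = m.+1%:R * 'C(n, m.+1)%:R :> R.
  by rewrite -!natrM mul_bin_diag.
set r := Num.sqrt _.
have -> : 4 * (m.+1%:R ^+ 2 / r) * 'C(n, m.+1)%:R =
    4 * m.+1%:R / r * (m.+1%:R * 'C(n, m.+1)%:R) by ring.
rewrite -E [leRHS](_ : _ = n%:R *
  (2 * m.+1%:R / r * 'C(n.-1, m)%:R + 2 * m.+1%:R / r * 'C(n.-1, m)%:R)) //.
by ring.
Qed.

Lemma dist_broadcast_planted_le F k : (0 < k <= n)%N ->
  \sum_s `|\sum_(A | broadcast F A == s) (A_rand R A - A_planted R k A)|
  <= 4 * (k%:R ^+ 2 / Num.sqrt n%:R).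
Proof.
move=> kn; have /andP[_ kn'] := kn.
have cE : #|[pred C : {set 'I_n} | #|C| == k]| = 'C(n, k).
  by rewrite -[in RHS](card_ord n) -card_draws cardsE.
have b0 : 0 < 'C(n, k)%:R :> R by rewrite ltr0n bin_gt0.
(* Multiplying by the number of cliques clears the normalisation of [A_planted]; the triangle
   inequality then brings the sum over [C] outside. *)
rewrite -(ler_pM2r b0); apply: le_trans (sum_clique_shift_le F kn).
apply: le_trans (ler_sum _ (fun C _ => dist_broadcast_clique_le F C)).
rewrite exchange_big /= mulr_suml; apply: ler_sum => s _.
rewrite -[X in _ * X <= _]ger0_norm ?(ltW b0) // -normrM.
apply: le_trans (ler_norm_sum _ _ _); rewrite exchange_big /= mulr_suml.
rewrite le_eqVlt; apply/orP; left; apply/eqP; congr `|_|; apply: eq_bigr => A _.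
rewrite sumrB sumr_const cE /A_planted cE mulrBl mulr_natr; congr (_ - _).
by rewrite mulrAC mulVf ?mul1r // gt_eqF.
Qed.

End OneRound.

Theorem theorem1p6 (R : realType) :
  exists c : R, forall (n k : nat) (Pi : bcast1 R n 1),
    (1 <= n)%N -> (1 <= k <= n)%N ->
    stat_dist (transcript_dist Pi (@A_rand R n))
              (transcript_dist Pi (@A_planted R n k))
      <= c * (k%:R ^+ 2 / Num.sqrt n%:R).
Proof.
(* The 2 is the bound 4 on the sum of differences, halved by [stat_dist]. *)
exists 2 => n k Pi _ kn; set r := _ / _.
rewrite /stat_dist ler_pdivrMl //.
pose wt F := fine (prob Pi [set w | strategy (Pi := Pi) w = F]%classic).
have -> : 2 * (2 * r) = \sum_F wt F * (4 * r).
  by rewrite -mulr_suml sum_strategy mul1r; ring.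
have wt0 F : 0 <= wt F by rewrite fine_ge0.
rewrite sum_tuple1.
(* By convexity it suffices to bound each deterministic strategy, since the weights do not depend on
   the input law. *)
apply: (@le_trans _ _ (\sum_(s : {ffun 'I_n -> bool}) \sum_F
   wt F * `|\sum_(A | broadcast F A == s) (A_rand R A - A_planted R k A)|)).
  apply: ler_sum => s _; rewrite !transcript_dist_mixture -sumrB.
  apply: le_trans (ler_norm_sum _ _ _) _; apply: ler_sum => F _.
  by rewrite -mulrBr -sumrB normrM ger0_norm ?wt0.
rewrite exchange_big /=; apply: ler_sum => F _; rewrite -mulr_sumr.
apply: ler_wpM2l; first exact: wt0.
exact: dist_broadcast_planted_le.
Qed.
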